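(* Let $t\ge 2$ be an integer. For $n\ge 0$ let $c_n$ denote the number of finite sequences $(a_0,a_1,\ldots,a_l)$ with $l\ge 0$, each $a_i$ a nonnegative integer, $a_l>0$, $\sum_{i=0}^l a_i = 1+n(t-1)$ and $\sum_{i=0}^l a_i t^{-i}=1$ (equivalently, $c_n$ is the number of equivalence classes of $t$-ary rooted trees with $n$ inner vertices, two trees being equivalent if they have the same number of leaves at distance $i$ from the root for every $i$). Let $F(q)=\sum_{n\ge0}c_nq^n$. Then \[ F(q)=\frac{\displaystyle\sum_{j=0}^{\infty}(-1)^j q^{[j]}\prod_{i=1}^{j}\frac{q^{[i]}}{1-q^{[i]}}}{\displaystyle\sum_{j=0}^\infty (-1)^{j} \prod_{i=1}^{j}\frac{q^{[i]}}{1-q^{[i]}}}, \] where $[k]:=1+t+t^2+\cdots+t^{k-1}$ (so $[0]=0$).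
   Context: A $t$-ary rooted tree here is a rooted tree in which every vertex is either a leaf or has exactly $t$ children; inner vertices are the non-leaves (the root is an inner vertex unless the tree is a single vertex). Empty products equal $1$. The identity may be read as an identity of formal power series in $q$ (both sums converge formally, and the denominator has constant term $1$), and equally as an identity of analytic functions for $|q|<1/2$. *)

(* Defs.v *)
From HB Require Import structures.
From mathcomp Require Import all_boot all_order all_algebra finmap.
From mathcomp Require Import zify.
From mathcomp Require Import boolp classical_sets cardinality.

Set Implicit Arguments.
Unset Strict Implicit.
Unset Printing Implicit Defensive.

Import Order.TTheory GRing.Theory Num.Theory.
Local Open Scope ring_scope.

(* A record rather than an alias of [nat -> R], since the latter carries the
   pointwise ring structure. *)
Record fps (R : Type) := Fps { fcoef : nat -> R }.

HB.instance Definition _ (R : Type) := gen_eqMixin (fps R).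
HB.instance Definition _ (R : Type) := gen_choiceMixin (fps R).

Lemma fpsP (R : Type) (a b : fps R) : (forall n, fcoef a n = fcoef b n) <-> a = b.
Proof. by split=> [|-> //]; case: a b => [a] [b] /= /funext ->. Qed.

Section FpsRing.
Variable R : comUnitRingType.
Implicit Types a b c : fps R.

Definition fps_zero : fps R := Fps (fun _ => 0).
Definition fps_add a b : fps R := Fps (fun n => fcoef a n + fcoef b n).
Definition fps_opp a : fps R := Fps (fun n => - fcoef a n).

Fact fps_addA : associative fps_add.
Proof. by move=> a b c; apply/fpsP => n; rewrite /= addrA. Qed.
Fact fps_addC : commutative fps_add.
Proof. by move=> a b; apply/fpsP => n; rewrite /= addrC. Qed.
Fact fps_add0 : left_id fps_zero fps_add.
Proof. by move=> a; apply/fpsP => n; rewrite /= add0r. Qed.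
Fact fps_addN : left_inverse fps_zero fps_opp fps_add.
Proof. by move=> a; apply/fpsP => n; rewrite /= addNr. Qed.

HB.instance Definition _ :=
  GRing.isZmodule.Build (fps R) fps_addA fps_addC fps_add0 fps_addN.

Definition fps_one : fps R := Fps (fun n => (n == 0%N)%:R).
Definition fps_mul a b : fps R :=
  Fps (fun n => \sum_(i < n.+1) fcoef a i * fcoef b (n - i)).

Definition fps_trunc m a : {poly R} := \poly_(i < m.+1) fcoef a i.

Lemma coef_fps_trunc m a i : (i <= m)%N -> (fps_trunc m a)`_i = fcoef a i.
Proof. by move=> im; rewrite coef_poly ltnS im. Qed.

Lemma fcoef_mul_trunc m a b n : (n <= m)%N ->
  fcoef (fps_mul a b) n = (fps_trunc m a * fps_trunc m b)`_n.
Proof.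
move=> nm; rewrite coefM /=; apply: eq_bigr => i _.
by rewrite !coef_fps_trunc //; have := ltn_ord i; lia.
Qed.

Fact fps_mulC : commutative fps_mul.
Proof.
by move=> a b; apply/fpsP => n; rewrite !(fcoef_mul_trunc _ _ (leqnn n)) mulrC.
Qed.

Fact fps_mulA : associative fps_mul.
Proof.
move=> a b c; apply/fpsP => n.
transitivity (fps_trunc n a * fps_trunc n b * fps_trunc n c)`_n.
  rewrite -mulrA coefM; apply: eq_bigr => i _.
  by rewrite coef_fps_trunc ?(@fcoef_mul_trunc n) //; have := ltn_ord i; lia.
rewrite coefM; apply: eq_bigr => i _.
by rewrite coef_fps_trunc ?(@fcoef_mul_trunc n) //; have := ltn_ord i; lia.
Qed.

Fact fps_mul1 : left_id fps_one fps_mul.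
Proof.
move=> a; apply/fpsP => n; rewrite /= big_ord_recl /= mul1r subn0.
by rewrite big1 ?addr0 // => i _; rewrite mul0r.
Qed.

Fact fps_mulDl : left_distributive fps_mul fps_add.
Proof.
move=> a b c; apply/fpsP => n; rewrite /= -big_split /=.
by apply: eq_bigr => i _; rewrite mulrDl.
Qed.

Fact fps_one_neq0 : fps_one != 0.
Proof.
apply/eqP => /fpsP/(_ 0%N) /= /eqP; rewrite (_ : (1%:R == 0 :> R) = false) //.
by rewrite oner_eq0.
Qed.

HB.instance Definition _ := GRing.Zmodule_isComNzRing.Build (fps R)
  fps_mulA fps_mulC fps_mul1 fps_mulDl fps_one_neq0.

Definition fps_unit : {pred fps R} := fun a => fcoef a 0%N \is a GRing.unit.

(* The coefficients of index n, n - 1, ..., 0 (in this order) of the inverse b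
   of a, from b_0 = a_0^-1 and b_n = - a_0^-1 * \sum_(1 <= i <= n) a_i b_(n-i). *)
Fixpoint fps_inv_coefs a n : seq R :=
  if n is m.+1 then
    let s := fps_inv_coefs a m in
    - (fcoef a 0%N)^-1 * (\sum_(i < m.+1) fcoef a i.+1 * s`_i) :: s
  else [:: (fcoef a 0%N)^-1].

Definition fps_inv a : fps R :=
  if a \in fps_unit then Fps (fun n => head 0 (fps_inv_coefs a n)) else a.

Lemma nth_fps_inv_coefs a n i : (i <= n)%N ->
  (fps_inv_coefs a n)`_i = head 0 (fps_inv_coefs a (n - i)).
Proof.
elim: n i => [|n IHn] [|i] //= lin.
by rewrite IHn.
Qed.

Fact fps_mulV : {in fps_unit, left_inverse 1 fps_inv *%R}.
Proof.
move=> a ua; rewrite mulrC /fps_inv ua; apply/fpsP => -[|n] /=.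
  by rewrite big_ord1 /= mulrV.
rewrite big_ord_recl /= mulNr mulrN mulVKr //.
rewrite (_ : _%:R = 0) // addrC; apply/eqP; rewrite subr_eq0; apply/eqP.
apply: eq_bigr => i _; rewrite /bump /= add1n subSS nth_fps_inv_coefs //.
by have := ltn_ord i; lia.
Qed.

Fact fps_unitPl a b : b * a = 1 -> fps_unit a.
Proof.
move=> /fpsP/(_ 0%N) /=; rewrite big_ord1 subnn => ba1.
by apply/unitrP; exists (fcoef b 0%N); split=> //; rewrite mulrC.
Qed.

Fact fps_inv_out : {in [predC fps_unit], fps_inv =1 id}.
Proof. by move=> a; rewrite inE /fps_inv => /negbTE ->. Qed.

HB.instance Definition _ := GRing.ComNzRing_hasMulInverse.Build (fps R)
  fps_mulV fps_unitPl fps_inv_out.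

End FpsRing.

Definition fps_X (R : comUnitRingType) : fps R := Fps (fun n => (n == 1%N)%:R).

(* Formal convergence of the series \sum_j u_j to s: each coefficient of the
   partial sums is eventually equal to that of s. *)
Definition fps_sums_to (R : comUnitRingType) (u : nat -> fps R) (s : fps R) : Prop :=
  forall n, exists J, forall m, (J <= m)%N ->
    fcoef (\sum_(0 <= j < m) u j) n = fcoef s n.

Definition admissible (t n : nat) : set (seq nat) :=
  [set a : seq nat |
    [/\ (0 < size a)%N, (0 < last 0%N a)%N,
        (\sum_(i < size a) nth 0%N a i = 1 + n * (t - 1))%N
      & \sum_(i < size a) (nth 0%N a i)%:R * (t%:R : rat) ^- i = 1]]%classic.

Lemma size_weighted_seq (t : nat) (a : seq nat) (T : nat) : (1 < t)%N ->
  (0 < last 0%N a)%N ->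
  \sum_(i < size a) (nth 0%N a i)%:R * (t%:R : rat) ^- i = T%:R ->
  (size a + T <= (\sum_(i < size a) nth 0%N a i).+1)%N.
Proof.
move=> t1; have t0 : t%:R != 0 :> rat by rewrite pnatr_eq0; lia.
elim: a T => [|x [|y a] IHa] T //.
  rewrite /= !big_ord1 /= expr0 invr1 mulr1 => _ /eqP.
  by rewrite eqr_nat => /eqP ->; lia.
rewrite [last _ _]/=; rewrite -[last y a]/(last 0%N (y :: a)).
move: (y :: a) (isT : (0 < size (y :: a))%N) IHa => s sz IHa s_gt0.
rewrite [size _]/= !big_ord_recl [nth _ _ ord0]/= expr0 invr1 mulr1 => xT.
set W := \sum_(i < size s) (nth 0%N s i)%:R * (t%:R : rat) ^- i.
have WE : W = t%:R * (T%:R - x%:R).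
  rewrite -xT addrC addKr mulr_sumr; apply: eq_bigr => i _.
  by rewrite lift0 exprS invfM mulrCA mulVKf.
have W_gt0 : 0 < W.
  rewrite /W -(prednK sz) big_ord_recr /= ltr_wpDl //.
    by apply: sumr_ge0 => i _; rewrite mulr_ge0 ?ler0n ?invr_ge0 ?exprn_ge0 ?ler0n.
  rewrite nth_last mulr_gt0 ?ltr0n //.
  by rewrite invr_gt0 exprn_gt0 // ltr0n; lia.
have xT' : (x < T)%N.
  rewrite -(ltr_nat rat) -subr_gt0 -(@pmulr_rgt0 _ t%:R) -?WE //.
  by rewrite ltr0n; lia.
have := IHa (t * (T - x))%N s_gt0.
rewrite -/W WE natrM natrB ?(ltnW xT') // => /(_ erefl).
set S1 := (\sum_(i < size s) nth 0%N s i)%N => H.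
have : (T - x + 1 <= t * (T - x))%N by nia.
by lia.
Qed.

(* The cardinal in [admissible_count] is that of a finite set ([fset_set] of an
   infinite set would be empty). *)
Lemma finite_admissible (t n : nat) : (1 < t)%N -> finite_set (admissible t n).
Proof.
move=> t1; pose B := (n * (t - 1)).+2.
pose f (u : {m : 'I_B & m.-tuple 'I_B}) : seq nat :=
  map (@nat_of_ord B) (tval (tagged u)).
apply: (@sub_finite_set _ _ (f @` setT)); last exact/finite_image/finite_finset.
move=> a [_ alast asum awt].
have sB : (size a < B)%N.
  by have := @size_weighted_seq t a 1 t1 alast awt; rewrite asum /B; lia.
have aB i : (i < size a)%N -> (nth 0%N a i < B)%N.
  move=> ia; rewrite /B ltnS -add1n -asum (bigD1 (Ordinal ia)) //=.
  exact: leq_addr.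
pose s : seq 'I_B := [seq inord i | i <- a].
have szs : size s == Ordinal sB by rewrite size_map.
exists (Tagged (fun m : 'I_B => m.-tuple 'I_B) (Tuple szs)) => //.
rewrite /f /= /s -map_comp -[RHS]map_id.
apply/eq_in_map => x /(nthP 0%N)[i ia <-] /=.
by rewrite inordK // aB.
Qed.

Definition admissible_count (t n : nat) : nat := #|` fset_set (admissible t n)|.

Definition gen_series (t : nat) : fps rat := Fps (fun n => (admissible_count t n)%:R).

Definition repunit (t k : nat) : nat := \sum_(i < k) t ^ i.

Definition qprod (t j : nat) : fps rat :=
  \prod_(1 <= i < j.+1) (fps_X rat ^+ repunit t i / (1 - fps_X rat ^+ repunit t i)).

(* Main.v *)
(* Reading a tree level by level, let G_r count, by number of inner vertices, the
   level profiles of forests of r trees. If m of the r roots are inner vertices,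
   the next level has t m vertices, so G_0 = 1 and
   G_{r+1} - G_r = q^{r+1} G_{t(r+1)}.  The ansatz \sum_j b_j q^{r e_j} for this
   recurrence forces e_{j+1} = 1 + t e_j, i.e. e_j = [j], and
   b_{j+1} = - b_j q^{[j+1]} / (1 - q^{[j+1]}), giving a solution u_r.  A solution
   is determined by its value at r = 0, so G_r u_0 = u_r, and F = G_1 = u_1 / u_0. *)

Require Import Defs.
From mathcomp Require Import all_boot all_order all_algebra.
From mathcomp Require Import finmap boolp classical_sets cardinality zify ring.
Import Order.TTheory GRing.Theory Num.Theory.
Local Open Scope ring_scope.

(** * Coefficients of formal power series, and uniqueness for the recurrence *)

Section Coefficients.
Variable R : comUnitRingType.
Implicit Types a b c : fps R.

Lemma fcoefD a b n : fcoef (a + b) n = fcoef a n + fcoef b n.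
Proof. by []. Qed.

Lemma fcoefN a n : fcoef (- a) n = - fcoef a n.
Proof. by []. Qed.

Lemma fcoef1 n : fcoef (1 : fps R) n = (n == 0%N)%:R.
Proof. by []. Qed.

Lemma fcoefM a b n : fcoef (a * b) n = \sum_(i < n.+1) fcoef a i * fcoef b (n - i).
Proof. by []. Qed.

Lemma fcoefM0 a b : fcoef (a * b) 0 = fcoef a 0 * fcoef b 0.
Proof. by rewrite fcoefM big_ord1. Qed.

Lemma fcoefX a : fcoef (fps_X R * a) 0 = 0 /\
  forall n, fcoef (fps_X R * a) n.+1 = fcoef a n.
Proof.
split=> [|n]; first by rewrite fcoefM0 /= mul0r.
rewrite fcoefM big_ord_recl big_ord_recl /= mul0r add0r mul1r subSS subn0.
by rewrite big1 ?addr0 // => i _; rewrite mul0r.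
Qed.

Lemma fcoefXnM k a n :
  fcoef (fps_X R ^+ k * a) n = if (k <= n)%N then fcoef a (n - k) else 0.
Proof.
elim: k n => [|k IHk] n; first by rewrite mul1r subn0.
rewrite exprS -mulrA; have [X0 XS] := fcoefX (fps_X R ^+ k * a).
by case: n => [|n]; rewrite ?X0 // XS IHk.
Qed.

Lemma fcoefXn k n : fcoef (fps_X R ^+ k) n = (n == k)%:R.
Proof.
rewrite -[_ ^+ k]mulr1 fcoefXnM fcoef1.
case: leqP => kn; first by rewrite subn_eq0 eqn_leq kn andbT.
by rewrite ltn_eqF.
Qed.

Lemma eq_fcoefM a b c n : (forall i, (i <= n)%N -> fcoef a i = fcoef b i) ->
  fcoef (c * a) n = fcoef (c * b) n.
Proof.
by move=> ab; rewrite !fcoefM; apply: eq_bigr => i _; rewrite ab // leq_subr.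
Qed.

Lemma unit_1subXn k : (0 < k)%N -> 1 - fps_X R ^+ k \is a GRing.unit.
Proof.
move=> k0; rewrite -[_ \is a _]/(fcoef _ 0%N \is a GRing.unit).
by rewrite fcoefD fcoefN fcoef1 fcoefXn (ltn_eqF k0) subr0 unitr1.
Qed.

(* The recurrence expresses the n-th coefficient of [D r] through lower
   coefficients of the [D (t * m)], 1 <= m <= r. *)
Lemma recurrence_eq0 t (D : nat -> fps R) : D 0%N = 0 ->
    (forall r, D r.+1 = D r + fps_X R ^+ r.+1 * D (t * r.+1)%N) ->
  forall r, D r = 0.
Proof.
move=> D0 DS r; apply/fpsP => n.
elim/ltn_ind: n r => n IHn; elim=> [|r IHr]; first by rewrite D0.
rewrite DS fcoefD IHr add0r fcoefXnM; case: leqP => // rn.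
by apply: IHn; lia.
Qed.

End Coefficients.

Lemma repunitS t k : repunit t k.+1 = (1 + t * repunit t k)%N.
Proof.
rewrite /repunit big_ord_recl big_distrr /=; congr (_ + _)%N.
by apply: eq_bigr => i _; rewrite /bump /= expnS.
Qed.

(** * The explicit solution $u_r$ of the recurrence as a q-series *)

Section QSeries.
Variable t : nat.
Local Notation q := (fps_X rat).

Lemma qprod0 : qprod t 0 = 1.
Proof. by rewrite /qprod big_geq. Qed.

Lemma qprodS j : qprod t j.+1 =
  qprod t j * (q ^+ repunit t j.+1 / (1 - q ^+ repunit t j.+1)).
Proof. by rewrite /qprod big_nat_recr. Qed.

(** Since $[i] \ge 1$, each factor yields at least one power of $q$; this crude bound suffices for
    formal convergence. *)
Lemma qprod_dvd j : exists b, qprod t j = q ^+ j * b.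
Proof.
elim: j => [|j [b IHj]]; first by exists 1; rewrite qprod0 mulr1.
exists (b * (q ^+ (t * repunit t j) / (1 - q ^+ repunit t j.+1))).
rewrite qprodS IHj {1}repunitS exprD expr1 exprS; ring.
Qed.

Definition qterm r j : fps rat := (-1) ^+ j * q ^+ (r * repunit t j) * qprod t j.

Lemma qterm0 r : qterm r 0 = 1.
Proof. by rewrite /qterm /repunit big_ord0 muln0 qprod0 !expr0 !mulr1. Qed.

Lemma fcoef_qterm_eq0 r j n : (n < j)%N -> fcoef (qterm r j) n = 0.
Proof.
move=> nj; rewrite /qterm; have [b ->] := qprod_dvd j.
by rewrite mulrCA fcoefXnM leqNgt nj.
Qed.

(** With $e = [j+1]$, the factor $q^{(r+1)e} - q^{re} = -q^{re}(1 - q^e)$ cancels the newest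
    denominator of [qprod], and $e = 1 + t[j]$ splits the remaining $q^{(r+1)e}$. *)
Lemma qtermS r j :
  qterm r.+1 j.+1 - qterm r j.+1 = q ^+ r.+1 * qterm (t * r.+1) j.
Proof.
rewrite /qterm qprodS; set e := repunit t j.+1.
have uq : 1 - q ^+ e \is a GRing.unit by rewrite unit_1subXn // /e repunitS.
have -> : q ^+ r.+1 * ((-1) ^+ j * q ^+ (t * r.+1 * repunit t j) * qprod t j)
    = (-1) ^+ j * q ^+ (r.+1 * e) * qprod t j.
  by rewrite /e repunitS mulnDr muln1 exprD (mulnC t) -mulnA; ring.
apply: (mulIr uq); rewrite mulrBl !mulrA !(mulrVK uq) mulSn exprD exprS; ring.
Qed.

(** Terms of index above [n] are divisible by $q^{n+1}$, so the coefficient of index [n] is already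
    final in this partial sum. *)
Definition qseries r : fps rat :=
  Fps (fun n => fcoef (\sum_(0 <= j < n.+1) qterm r j) n).

Lemma fcoef_qseries r n m : (n < m)%N ->
  fcoef (\sum_(0 <= j < m) qterm r j) n = fcoef (qseries r) n.
Proof.
elim: m => // m IHm; rewrite ltnS leq_eqVlt => /predU1P[-> //|nm].
by rewrite big_nat_recr // fcoefD fcoef_qterm_eq0 // addr0 IHm.
Qed.

Lemma qseries_sums r : fps_sums_to (qterm r) (qseries r).
Proof. by move=> n; exists n.+1 => m; apply: fcoef_qseries. Qed.

Lemma qseriesS r : qseries r.+1 = qseries r + q ^+ r.+1 * qseries (t * r.+1).
Proof.
have partial M : \sum_(0 <= j < M.+1) qterm r.+1 j =
    \sum_(0 <= j < M.+1) qterm r j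
    + q ^+ r.+1 * \sum_(0 <= j < M) qterm (t * r.+1) j.
  rewrite !big_nat_recl // !qterm0 -addrA.
  congr (_ + _); rewrite mulr_sumr -big_split /=.
  by apply: eq_bigr => j _; rewrite -qtermS addrC subrK.
(* Taking [n.+2] terms on the left leaves [n.+1] in the shifted sum, enough for all coefficients up
   to [n]. *)
apply/fpsP => n; rewrite -(@fcoef_qseries _ n n.+2) // partial !fcoefD.
congr (_ + _); first exact: fcoef_qseries.
by apply: eq_fcoefM => i ni; apply: fcoef_qseries.
Qed.

Lemma fcoef_qseries0 : fcoef (qseries 0) 0 = 1.
Proof. by rewrite /= big_nat1 qterm0. Qed.

End QSeries.

(** * Level profiles of forests and their generating series *)

Section Counting.
Variable t : nat.
Hypothesis t_gt1 : (1 < t)%N.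

Definition weight (a : seq nat) : rat :=
  \sum_(i < size a) (nth 0%N a i)%:R * (t%:R : rat) ^- i.

Definition leaves (a : seq nat) : nat := \sum_(i < size a) nth 0%N a i.

Let t_neq0 : t%:R != 0 :> rat.
Proof. by rewrite pnatr_eq0; lia. Qed.

Lemma weight_nil : weight [::] = 0.
Proof. by rewrite /weight big_ord0. Qed.

Lemma weight_cons x s : weight (x :: s) = x%:R + weight s / t%:R.
Proof.
rewrite /weight big_ord_recl /= expr0 invr1 mulr1; congr (_ + _).
rewrite mulr_suml; apply: eq_bigr => i _.
by rewrite -[bump 0 i]/i.+1 exprSr invfM mulrA.
Qed.

Lemma leaves_nil : leaves [::] = 0%N.
Proof. by rewrite /leaves big_ord0. Qed.

Lemma leaves_cons x s : leaves (x :: s) = (x + leaves s)%N.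
Proof. by rewrite /leaves big_ord_recl. Qed.

Lemma weight_ge0 s : 0 <= weight s.
Proof.
by apply: sumr_ge0 => i _; rewrite mulr_ge0 ?invr_ge0 ?exprn_ge0 ?ler0n.
Qed.

(** Of [r] roots, [x] are leaves and the others have [t * (r - x)] children, the roots of the next
    level. The bound on [x] comes from nonnegativity of weights. *)
Lemma weight_cons_eq x s r : weight (x :: s) = r%:R <->
  (x <= r)%N /\ weight s = (t * (r - x))%:R.
Proof.
rewrite weight_cons; split=> [xr|[xr ->]]; last first.
  by rewrite natrM mulrC mulKf // -natrD subnKC.
have le_xr : (x <= r)%N.
  by rewrite -(ler_nat rat) -xr lerDl divr_ge0 ?weight_ge0.
by split=> //; rewrite natrM natrB // -xr [_ - x%:R]addrC addKr mulrC divfK.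
Qed.

Lemma weight_leaves s T : (0 < last 1 s)%N -> weight s = T%:R -> (T <= leaves s)%N.
Proof.
case: s => [_|x s ls /(@size_weighted_seq t (x :: s) T t_gt1 ls)]; last first.
  by rewrite -/(leaves _) [size _]/=; lia.
by rewrite weight_nil => /eqP; rewrite eq_sym pnatr_eq0 => /eqP ->.
Qed.

(* Leaf counts per level of a forest of [r] trees with [n] inner vertices in
   total; the default value [1] of [last] admits the empty sequence, which
   occurs exactly when [r = 0]. *)
Definition profile r n a : Prop :=
  [/\ (0 < last 1 a)%N, leaves a = (r + n * (t - 1))%N & weight a = r%:R].

Lemma weight_eq0 s : weight s = 0 -> (0 < last 1 s)%N -> s = [::].
Proof.
elim: s => // x s IHs /(weight_cons_eq x s 0)[].
rewrite leqn0 => /eqP -> /=; rewrite muln0 => s0 ls.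
by case: s s0 ls IHs => // y s s0 ls /(_ s0 ls).
Qed.

Lemma profile0 n a : profile 0 n a <-> n = 0%N /\ a = [::].
Proof.
split=> [[la ea wa]|[-> ->]]; last by rewrite /profile leaves_nil weight_nil.
move: (weight_eq0 _ wa la) ea => ->; rewrite leaves_nil; split=> //; nia.
Qed.

(** Here [m] is the number of inner roots. The tail has $m + n(t-1)$ leaves, and at least $tm$ by
    [weight_leaves], whence [m <= n]. *)
Lemma profile_cons r n x s : profile r.+1 n (x :: s) <->
  exists m, [/\ (m <= r.+1)%N, (m <= n)%N, x = (r.+1 - m)%N
              & profile (t * m) (n - m) s].
Proof.
split=> [[/= lx ex /weight_cons_eq[xr ws]]|[m [mr mn -> [ls es ws]]]].
  rewrite leaves_cons in ex.
  have ls : (0 < last 1 s)%N by case: (s) lx.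
  have := weight_leaves _ _ ls ws.
  exists (r.+1 - x)%N; split; rewrite ?leq_subr ?subKn //; first by nia.
  by split=> //; nia.
split; last 1 first.
- by apply/weight_cons_eq; rewrite leq_subr subKn.
(* An empty tail forces [m = 0], so the last entry is [r.+1], which is positive. *)
- case: s ls ws {es} => //= _; rewrite weight_nil => /eqP.
  by rewrite eq_sym pnatr_eq0; nia.
by rewrite leaves_cons es; nia.
Qed.

(* [k] is fuel; it suffices that [n < k] or [r = 0]. *)
Fixpoint profiles k r n : seq (seq nat) :=
  if r is 0 then if n is 0 then [:: [::]] else [::]
  else if k is k.+1 then
    [seq (r - m)%N :: s | m <- [seq m <- iota 0 r.+1 | (m <= n)%N],
                          s <- profiles k (t * m)%N (n - m)%N]
  else [::].

Lemma profilesS k r n : profiles k.+1 r.+1 n =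
  [seq (r.+1 - m)%N :: s | m <- [seq m <- iota 0 r.+2 | (m <= n)%N],
                           s <- profiles k (t * m)%N (n - m)%N].
Proof. by []. Qed.

Lemma profilesP k r n a : (n < k)%N || (r == 0%N) ->
  reflect (profile r n a) (a \in profiles k r n).
Proof.
move=> knr; apply: (iffP idP).
  elim: k r n a knr => [|k IHk] [|r] n a // knr.
  - by case: n {knr} => // /[!inE] /eqP ->; apply/profile0.
  - by case: n {knr} => // /[!inE] /eqP ->; apply/profile0.
  rewrite profilesS => /allpairsPdep[m [s [+ + ->]]].
  rewrite mem_filter mem_iota => /andP[mn mr] /IHk ms.
  by apply/profile_cons; exists m; split=> //; apply: ms; nia.
elim: k r n a knr => [|k IHk] [|r] n a // knr.
- by case/profile0 => -> ->.
- by case/profile0 => -> ->.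
case: a => [[_ _]|x s /profile_cons[m [mr mn -> ms]]].
  by rewrite weight_nil => /esym /eqP; rewrite pnatr_eq0.
rewrite profilesS; apply/allpairsPdep; exists m, s; split=> //.
  by rewrite mem_filter mn mem_iota.
by apply: IHk => //; nia.
Qed.

Lemma uniq_profiles k r n : uniq (profiles k r n).
Proof.
elim: k r n => [|k IHk] [|r] n; try by case: n.
rewrite profilesS; apply: allpairs_uniq_dep => //; first by rewrite filter_uniq ?iota_uniq.
move=> _ _ /allpairsPdep[m [s [+ _ ->]]] /allpairsPdep[m' [s' [+ _ ->]]] /=.
rewrite !mem_filter !mem_iota => /andP[_ mr] /andP[_ mr'] [mm ->].
by have -> : m = m' by lia.
Qed.

Definition profile_count r n := size (profiles n.+1 r n).

Lemma size_profiles k r n : (n < k)%N || (r == 0%N) ->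
  size (profiles k r n) = profile_count r n.
Proof.
move=> knr; apply/perm_size/uniq_perm; rewrite ?uniq_profiles // => a.
by apply/profilesP/profilesP => //; rewrite ltnSn.
Qed.

Lemma profile_count0 n : profile_count 0 n = (n == 0%N).
Proof. by case: n. Qed.

Lemma profile_countE r n : profile_count r.+1 n =
  (\sum_(0 <= m < r.+2 | (m <= n)%N) profile_count (t * m) (n - m))%N.
Proof.
rewrite /profile_count profilesS size_allpairs_dep sumnE big_map.
rewrite -[RHS]big_filter; apply: eq_big_seq => m.
by rewrite mem_filter => /andP[mn _]; rewrite size_profiles //; nia.
Qed.

Definition profile_series r : fps rat := Fps (fun n => (profile_count r n)%:R).

Lemma profile_series0 : profile_series 0 = 1.
Proof. by apply/fpsP => n; rewrite /= profile_count0. Qed.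

(** In [profile_countE] the terms with [m <= r] add up to the count for [r]; the term [m = r.+1]
    gives the product. *)
Lemma profile_seriesS r : profile_series r.+1 =
  profile_series r + fps_X rat ^+ r.+1 * profile_series (t * r.+1).
Proof.
apply/fpsP => n; rewrite fcoefD fcoefXnM /= profile_countE.
rewrite big_mkcond big_nat_recr //= -big_mkcond natrD; congr (_ + _); last first.
  by case: ifP.
(* [profile_countE] needs at least one root; for [r = 0] just the term [m = 0] remains. *)
case: r => [|r]; last by rewrite profile_countE.
by rewrite big_mkcond big_nat1 /= muln0 subn0.
Qed.

(** A sequence of weight 1 is nonempty, so the two default values of [last] agree in effect. *)
Lemma admissibleE n a : admissible t n a <-> profile 1 n a.
Proof.
split=> [[sa la ea wa]|[la ea wa]]; first by split=> //; case: a sa la {ea wa}.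
case: a la ea wa => [_ _|//].
by rewrite weight_nil => /esym /eqP; rewrite oner_eq0.
Qed.

Lemma admissible_countE n : admissible_count t n = profile_count 1 n.
Proof.
apply/perm_size/uniq_perm; rewrite ?fset_uniq ?uniq_profiles // => a.
rewrite [LHS]in_fset_set; last exact: finite_admissible.
have mem_a : reflect (profile 1 n a) (a \in profiles n.+1 1 n).
  by apply: profilesP; rewrite ltnSn.
by apply/idP/mem_a => [/set_mem/admissibleE //|/admissibleE/mem_set].
Qed.

End Counting.

Theorem theorem1 (t : nat) (ht : (2 <= t)%N) :
  exists num den : fps rat,
    [/\ fps_sums_to
          (fun j => (-1) ^+ j * fps_X rat ^+ repunit t j * qprod t j) num,
        fps_sums_to (fun j => (-1) ^+ j * qprod t j) den,
        fcoef den 0%N = 1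
      & gen_series t = num / den].
Proof.
exists (qseries t 1), (qseries t 0); split.
- have -> : (fun j => (-1) ^+ j * fps_X rat ^+ repunit t j * qprod t j) = qterm t 1.
    by apply/funext => j; rewrite /qterm mul1n.
  exact: qseries_sums.
- have -> : (fun j => (-1) ^+ j * qprod t j) = qterm t 0.
    by apply/funext => j; rewrite /qterm mul0n mulr1.
  exact: qseries_sums.
- exact: fcoef_qseries0.
have -> : gen_series t = profile_series t 1.
  by apply/fpsP => n; rewrite /= admissible_countE.
have u0 : qseries t 0 \is a GRing.unit.
  by rewrite -[_ \is a _]/(fcoef _ 0%N \is a GRing.unit) fcoef_qseries0 unitr1.
(* The claim is now the case $r = 1$ of $G_r u_0 - u_r = 0$. *)
apply: (mulIr u0); rewrite (mulrVK u0); apply/subr0_eq.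
apply: (@recurrence_eq0 _ t
  (fun r => profile_series t r * qseries t 0 - qseries t r)) => [|r].
  by rewrite profile_series0 mul1r subrr.
by rewrite profile_seriesS // qseriesS; ring.
Qed.
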